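(* Let $A$ be a bounded subset of $\mathbb{R}$ which is additively left-stable, i.e. $\inf(A)=0$ and $(A+A)\cap[0,d]=A$, where $d=\operatorname{diam}(A)=\sup(A)-\inf(A)$. For $x\in\mathbb{R}$ write $A_x=A\cap[0,x]$, and let $\lambda$ denote inner Lebesgue measure. If $\lambda(A)=d/2>0$, then for all $x\in[0,d]$, $$\lambda(A_x)\le d\,h(x/d),$$ where $h$ is the continuous, piecewise affine function on $[0,1]$ defined by $h(0)=0$ and, for every integer $k\ge 2$ and every $x\in\left(\frac1k,\frac1{k-1}\right]$, $h(x)=\frac{1}{k+1}\left(2x-\frac1k\right)$.
   Context: $\lambda$ is the inner Lebesgue measure: $\lambda(X)$ is the supremum of the Lebesgue measures of closed sets contained in $X$. For sets $X,Y\subset\mathbb{R}$, $X+Y=\{x+y: x\in X, y\in Y\}$. *)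

(* Defs.v *)
From HB Require Import structures.
From mathcomp Require Import all_boot all_order all_algebra.
From mathcomp Require Import all_classical all_reals all_analysis.
From mathcomp Require Import ring lra.
Set Implicit Arguments.
Unset Strict Implicit.
Unset Printing Implicit Defensive.
Import Order.TTheory GRing.Theory Num.Theory.
Import numFieldNormedType.Exports.
Local Open Scope classical_set_scope.
Local Open Scope ring_scope.

Section Defs.
Context {R : realType}.
Implicit Types (A X Y : set R) (x : R).

Definition inner_lebesgue X : \bar R :=
  ereal_sup [set lebesgue_measure K | K in [set K : set R | closed K /\ K `<=` X]].

Definition sumset X Y : set R := [set x + y | x in X & y in Y].

Definition diam A : R := sup A - inf A.

(* Nonemptiness is explicit because the library sets inf set0 = 0. *)
Definition left_stable A : Prop :=
  [/\ A !=set0, bounded_set A, inf A = 0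
    & sumset A A `&` `[0, diam A] = A].

Definition hline (k : nat) x : R := k.+1%:R^-1 * (2 * x - k%:R^-1).

(* For 0 < x <= 1, the integer k >= 2 with 1/k < x <= 1/(k-1) is
   floor (1/x) + 1; see [hE] for the piecewise description. *)
Definition h x : R := if x == 0 then 0 else hline (Num.truncn x^-1).+1 x.

Lemma h0 : h 0 = 0.
Proof. by rewrite /h eqxx. Qed.

Lemma hE (k : nat) x : (2 <= k)%N -> x \in `]k%:R^-1, k.-1%:R^-1] ->
  h x = k.+1%:R^-1 * (2 * x - k%:R^-1).
Proof.
case: k => [//|k]; rewrite ltnS => k0; rewrite in_itv /= => /andP[kx xk].
have x0 : 0 < x by apply: le_lt_trans kx; rewrite invr_ge0.
rewrite /h gt_eqF// (_ : Num.truncn x^-1 = k)//.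
apply: truncn_def; apply/andP; split.
  by rewrite -[leLHS]invrK lef_pV2// posrE invr_gt0 ltr0n.
by rewrite -[ltRHS]invrK ltf_pV2// posrE invr_gt0 ltr0n.
Qed.

Lemma h_pieceP x : 0 < x <= 1 ->
  exists2 k : nat, (2 <= k)%N & x \in `]k%:R^-1, k.-1%:R^-1].
Proof.
move=> /andP[x0 x1]; have xV1 : 1 <= x^-1 by rewrite invf_ge1.
exists (Num.truncn x^-1).+1; first by rewrite ltnS truncn_gt0.
have /andP[lo hi] := truncn_itv (le_trans ler01 xV1).
rewrite in_itv /=; apply/andP; split.
  by rewrite -[ltRHS]invrK ltf_pV2// posrE ?invr_gt0 ?ltr0n.
rewrite -[leLHS]invrK lef_pV2// posrE ?invr_gt0//.
by rewrite ltr0n truncn_gt0.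
Qed.

Let hline_le (j k : nat) x : (2 <= j)%N -> (2 <= k)%N ->
  x \in `]k%:R^-1, k.-1%:R^-1] -> hline j x <= hline k x.
Proof.
case: k => [//|k]; rewrite in_itv/= => j2; rewrite ltnS => k1 /andP[kx xk].
rewrite /hline; have j0 : 0 < j%:R :> R by rewrite ltr0n (ltn_trans _ j2).
have k0 : 0 < k%:R :> R by rewrite ltr0n.
have jj : j.+1%:R = j%:R + 1 :> R by rewrite -natr1.
have kk : k.+1%:R = k%:R + 1 :> R by rewrite -natr1.
have kkk : k.+2%:R = k%:R + 2 :> R by rewrite -!natr1; ring.
rewrite -subr_ge0 jj kkk kk.
have -> : (k%:R + 2)^-1 * (2 * x - (k%:R + 1)^-1) -
  (j%:R + 1)^-1 * (2 * x - j%:R^-1) = ((j%:R + 1) * (k%:R + 2))^-1 *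
   ((j%:R - (k%:R + 1)) * (2 * x - (j%:R + k%:R + 2) / (j%:R * (k%:R + 1)))).
  field; rewrite !gt_eqF//; lra.
have jk0 : 0 < j%:R * (k%:R + 1) :> R by apply: mulr_gt0; lra.
apply: mulr_ge0; first by rewrite invr_ge0; apply: mulr_ge0; lra.
have kx' : 1 <= x * (k%:R + 1).
  by rewrite -ler_pdivrMr ?div1r -?kk ?ltW// kk; lra.
have xk' : x * k%:R <= 1 by rewrite -ler_pdivlMr ?div1r.
have [jk|kj] := leqP j k.+1; last first.
  have : k%:R + 2 <= j%:R :> R by rewrite -kkk ler_nat.
  move=> kj'; apply: mulr_ge0; first lra.
  by rewrite subr_ge0 ler_pdivrMr//; nra.
have [->|jk'] := eqVneq j k.+1; first by rewrite kk subrr mul0r.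
have jk2 : j%:R <= k%:R :> R.
  by rewrite ler_nat -ltnS ltn_neqAle jk' jk.
apply: mulr_le0; first lra.
by rewrite subr_le0 ler_pdivlMr//; nra.
Qed.

Let hline_mono (k : nat) x y : x <= y -> hline k x <= hline k y.
Proof.
move=> xy; rewrite /hline ler_pM2l ?invr_gt0 ?ltr0n// lerB// ler_pM2l//.
Qed.

Let hline_lip (k : nat) x y : (2 <= k)%N -> x <= y ->
  hline k y - hline k x <= y - x.
Proof.
move=> k2 xy; rewrite /hline -mulrBr ler_pdivrMl ?ltr0n//.
have : 2 <= k.+1%:R :> R by rewrite ler_nat leqW.
nra.
Qed.

Let h_lip x y : 0 <= x -> x <= y -> y <= 1 -> 0 <= h y - h x <= y - x.
Proof.
move=> x0 xy y1; have [y0|y0] := leP y 0.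
  have -> : y = x by lra.
  by rewrite !subrr lexx.
have [j j2 yj] : exists2 j : nat, (2 <= j)%N & y \in `]j%:R^-1, j.-1%:R^-1].
  by apply: h_pieceP; rewrite y0.
have hy : h y = hline j y by rewrite (hE j2 yj).
have [x0'|xn0] := leP x 0.
  have -> : x = 0 by lra.
  rewrite h0 !subr0 hy; move: yj; rewrite in_itv/= => /andP[jy _].
  have j0 : 0 < j%:R^-1 :> R by rewrite invr_gt0 ltr0n (ltn_trans _ j2).
  have j3 : 2 <= j.+1%:R :> R by rewrite ler_nat leqW.
  rewrite /hline; apply/andP; split.
    by apply: mulr_ge0; [rewrite invr_ge0|lra].
  by rewrite ler_pdivrMl ?ltr0n//; nra.
have [k k2 xk] : exists2 k : nat, (2 <= k)%N & x \in `]k%:R^-1, k.-1%:R^-1].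
  by apply: h_pieceP; rewrite xn0 (le_trans xy).
have hx : h x = hline k x by rewrite (hE k2 xk).
rewrite hx hy.
have := hline_le k2 j2 yj; have := hline_le j2 k2 xk.
have := hline_mono k xy; have := hline_lip j2 xy; lra.
Qed.

Lemma h_continuous : {within `[0, 1], continuous h}.
Proof.
apply/subspace_continuousP => x; rewrite /= in_itv/= => /andP[x0 x1].
apply/cvgrPdist_le => e e0; rewrite near_withinE.
near=> y; rewrite /= in_itv/= => /andP[y0 y1].
have xy : `|x - y| <= e.
  by near: y; apply: (@cvgr_dist_le _ _ _ _ _ id x) => //; exact: cvg_id.
apply: le_trans xy.
have [le|/ltW le] := leP x y.
  have /andP[? ?] := h_lip x0 le y1.
  by rewrite distrC ger0_norm// distrC ger0_norm// subr_ge0.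
have /andP[? ?] := h_lip y0 le x1.
by rewrite ger0_norm// ger0_norm// subr_ge0.
Unshelve. all: by end_near. Qed.

End Defs.

(* Main.v *)
(* Take x in A, write b for the inner measure of A_x and c_i for that of
   A ∩ [ix, (i+1)x], so that c_0 = b. Since A is stable and x is in A, the sum
   modulo x of the i-th block and A_x lies in the (i+1)-st block, and Raikov's
   inequality on the circle R/xZ gives c_(i+1) >= min(x, c_i + b) while
   (i+2)x <= d. On the other hand A_y has measure at most y/2 for all y <= d:
   if y is not in A, then A_y and y - A_y are disjoint, and the case y in A
   follows by comparison with the next gap of A, using that A has measure d/2.
   This excludes c_i = x, hence c_i >= (i+1)b. If (k-1)x <= d < kx, the k-th
   block is truncated by at most kx - d, and summing the k blocks gives
   k(k+1)/2 b <= kx - d/2, which is the claim. A general x is reduced to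
   elements of A close to sup A_x, since h is nondecreasing. Raikov's inequality
   is obtained from Cauchy-Davenport by cutting the circle in p equal arcs. *)
From HB Require Import structures.
Require Import Defs.
From mathcomp Require Import all_boot all_order all_algebra.
Set Implicit Arguments.
Unset Strict Implicit.
Unset Printing Implicit Defensive.
Import Order.TTheory GRing.Theory Num.Theory.
Local Open Scope ring_scope.

(** * Cauchy-Davenport in a prime field *)

(** Iterating the shift from [a] reaches [y] after [(y - a) / g] steps, this quotient being read as
    a natural number. *)
Lemma shift_stable_full (p : nat) (A : {set 'F_p}) (g a : 'F_p) :
  g != 0 -> a \in A -> (forall u, u \in A -> u + g \in A) -> A = [set: 'F_p].
Proof.
move=> g0 aA Ag; apply/setP => y; rewrite inE.
have An n : a + g *+ n \in A.
  by elim: n => [|n IHn]; rewrite ?addr0// mulrSr addrA Ag.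
by have := An (val ((y - a) / g)); rewrite -mulr_natr natr_Zp mulrC divfK// addrC subrK.
Qed.

(** Strong induction on [#|B|]. The direct cases are [B] a singleton and [A] the whole field;
    otherwise a Dyson transform makes [B] smaller. *)
Lemma cauchy_davenport (p : nat) (A B : {set 'F_p}) :
  prime p -> A != set0 -> B != set0 ->
  (minn p (#|A| + #|B|).-1 <= #|[set a + b | a in A, b in B]%R|)%N.
Proof.
move=> pp; have [n] := ubnP #|B|; elim: n => // n IHn in A B * => Bn A0 B0.
have [/set0Pn[a aA] /set0Pn[b bB]] := (A0, B0).
have [B1|/subsetPn[b' b'B]] := boolP (B \subset [set b]).
  have -> : B = [set b] by apply/eqP; rewrite eqEsubset B1 sub1set.
  rewrite cards1 addn1/= (leq_trans (geq_minr _ _))//.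
  rewrite -(card_imset _ (addIr b)); apply/subset_leq_card/subsetP => _ /imsetP[u uA ->].
  by apply/imset2P; exists u b; rewrite ?set11.
rewrite inE => b'b.
have [AT|AT] := eqVneq A [set: 'F_p].
  rewrite (leq_trans (geq_minl _ _))// -{1}(card_Fp pp) -cardsT -AT.
  rewrite -(card_imset _ (addIr b)); apply/subset_leq_card/subsetP => _ /imsetP[u uA ->].
  by apply/imset2P; exists u b.
(* Not being the whole field, [A] is not stable under the nonzero shift [b' - b]. With [e = c - b],
   the point [b + e] lies in [A] and [b' + e] does not, so [B'] will contain [b] but not [b']. *)
have [c cA cbA] : exists2 c, c \in A & c + (b' - b) \notin A.
  apply/exists_inP; apply: contraR AT; rewrite negb_exists_in => /forall_inP h.
  apply/eqP/(@shift_stable_full _ _ (b' - b) a) => //; first by rewrite subr_eq0.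
  by move=> u /h; rewrite negbK.
(* The Dyson transform by e keeps #|A| + #|B|, shrinks B strictly and does not
   enlarge the sumset. *)
pose e := c - b.
pose Be := [set u + e | u in B]; pose B' := [set u in B | u + e \in A].
have cBe : (#|A :|: Be| + #|B'| = #|A| + #|B|)%N.
  have -> : #|B'| = #|A :&: Be|.
    rewrite -(card_imset _ (addIr e)); congr #|pred_of_set _|; apply/setP => u.
    apply/imsetP/setIP => [[v]|[uA /imsetP[v vB uE]]].
      by rewrite inE => /andP[vB vA ->]; split=> //; apply/imsetP; exists v.
    by exists v; rewrite // inE vB -uE.
  by rewrite cardsUI card_imset//; exact: addIr.
have bB' : b \in B' by rewrite inE bB /e addrC subrK.
rewrite -cBe; apply: leq_trans (IHn (A :|: Be) B' _ _ _) _.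
- apply: leq_trans (_ : #|B| <= n)%N => //; apply/proper_card/properP; split.
    by apply/subsetP => u; rewrite inE => /andP[].
  by exists b' => //; rewrite inE b'B /= /e addrCA.
- by apply/set0Pn; exists c; rewrite inE cA.
- by apply/set0Pn; exists b.
apply/subset_leq_card/subsetP => _ /imset2P[u v /setUP uA + ->].
rewrite inE => /andP[vB vA]; apply/imset2P.
case: uA => [uA|/imsetP[w wB ->]]; first by exists u v.
(* The shift passes from [w] to [v], and [v + e] lies in [A] by the definition of [B']. *)
by exists (v + e) w => //; rewrite -addrA addrC [e + v]addrC.
Qed.

From mathcomp Require Import all_classical all_reals all_analysis.
From mathcomp Require Import measurable_realfun.
From mathcomp Require Import ring lra zify.
Import numFieldNormedType.Exports.
Local Open Scope classical_set_scope.
Local Open Scope ring_scope.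

(** * Finite Lebesgue measure and covers by intervals *)

Section FiniteMeasure.
Context {R : realType}.
Implicit Types (X K L : set R) (a b x w : R).
Local Notation mu := (@lebesgue_measure R).

(* Junk value 0 when the measure is infinite. *)
Definition mlen X : R := fine (mu X).

Lemma mu_itv a b : a <= b -> mu `[a, b] = (b - a)%:E.
Proof.
rewrite le_eqVlt => /predU1P[->|ab].
  by rewrite lebesgue_measure_itv/= lte_fin ltxx subrr.
by rewrite lebesgue_measure_itv/= lte_fin ab.
Qed.

Lemma mlenE a b X : measurable X -> X `<=` `[a, b] -> mu X = (mlen X)%:E.
Proof.
move=> mX Xab; rewrite fineK// ge0_fin_numE ?measure_ge0//.
apply: (@le_lt_trans _ _ (mu `[a, b])).
  by apply: le_measure => //; rewrite inE//; exact: measurable_itv.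
by rewrite lebesgue_measure_itv/=; case: ifP => _; rewrite ?ltry.
Qed.

(** The intervals are removed one at a time, so they may overlap; neighbouring closed cells do share
    endpoints. *)
Lemma mu_cells w (s : seq R) X : 0 <= w -> measurable X ->
  (forall t, X t -> exists2 c, c \in s & c <= t <= c + w) ->
  (mu X <= ((size s)%:R * w)%:E)%E.
Proof.
move=> w0; elim: s X => [|c s IHs] X mX Xs.
  rewrite (_ : X = set0) ?measure0 ?mul0r//.
    by apply/seteqP; split=> // t /Xs[].
have mI : measurable (`[c, c + w] : set R) by exact: measurable_itv.
have -> : mu X = (mu (X `\` `[c, (c + w)%R]) + mu (X `&` `[c, (c + w)%R]))%E.
  exact: measureDI.
rewrite /= -natr1 mulrDl mul1r EFinD.
apply: leeD.
  apply: IHs; first exact: measurableD.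
  move=> t [/Xs[d]]; rewrite inE => /orP[/eqP-> ctw|ds tw _]; last by exists d.
  by case; rewrite /= in_itv.
have {2}-> : w = (c + w) - c by ring.
rewrite -mu_itv; last by rewrite lerDl.
by apply: le_measure; rewrite ?inE//; exact: measurableI.
Qed.

End FiniteMeasure.

(** * Raikov's inequality on the circle *)

Section CircleSumset.
Context {R : realType}.
Implicit Types (X K L N : set R) (x w : R).

Lemma cell_index (p : nat) x t : prime p -> 0 < x -> 0 <= t <= x ->
  exists j : 'F_p, (val j)%:R * (x / p%:R) <= t <= (val j)%:R * (x / p%:R) + x / p%:R.
Proof.
move=> pp x0 /andP[t0 tx]; have p0 : 0 < p%:R :> R by rewrite ltr0n prime_gt0.
set w := x / p%:R; have w0 : 0 < w by rewrite divr_gt0.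
have valj (j : nat) : (j < p)%N -> val (j%:R : 'F_p) = j.
  by move=> jp; rewrite [LHS]val_Fp_nat// modn_small.
have pw : p%:R * w = x by rewrite /w mulrC divfK ?gt_eqF.
have p1 : p = p.-1.+1 by rewrite prednK ?prime_gt0.
have := truncn_itv (divr_ge0 t0 (ltW w0)).
set j := Num.truncn _ => /andP[]; rewrite ler_pdivlMr// ltr_pdivrMr// => jt tj.
have [jp|pj] := ltnP j p.
  exists (j%:R : 'F_p); rewrite valj// jt/= (le_trans (ltW tj))//.
  by rewrite -natr1 mulrDl mul1r.
(* Here [j >= p] forces [t = x], the right end of the last cell. *)
exists (p.-1%:R : 'F_p); rewrite valj; last by rewrite [ltnRHS]p1.
have e : p%:R = p.-1%:R + 1 :> R by rewrite natr1 -p1.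
have : p%:R <= j%:R :> R by rewrite ler_nat.
nra.
Qed.

(** Indices live in ['F_p] because adding them wraps around at [p], as adding points wraps around at
    [p * w]. *)
Definition cells (p : nat) w X : {set 'F_p} :=
  [set j | `[< exists2 k, X k & (val j)%:R * w <= k <= (val j)%:R * w + w >]].

Lemma mlen_cells (p : nat) x X : prime p -> 0 < x -> measurable X -> X `<=` `[0, x] ->
  mlen X <= #|cells p (x / p%:R) X|%:R * (x / p%:R).
Proof.
move=> pp x0 mX X0; set w := x / _; rewrite -lee_fin -(mlenE mX X0).
have -> : #|cells p w X| = size [seq (val j)%:R * w | j <- enum (cells p w X)].
  by rewrite size_map cardE.
apply: mu_cells => //; first by rewrite divr_ge0 ?ler0n ?(ltW x0).
move=> t Xt; have := X0 _ Xt; rewrite /= in_itv/= => tx.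
have [j jt] := cell_index pp x0 tx.
exists ((val j)%:R * w) => //; apply: map_f; rewrite mem_enum inE.
by apply/asboolP; exists t.
Qed.

Lemma dist_cells (a b w k l t : R) : a <= k <= a + w -> b <= l <= b + w ->
  a + b <= t <= a + b + w -> `|t - (k + l)| <= 2 * w.
Proof. by rewrite ler_norml; lra. Qed.

(** Cells bound measures only from above, so it is the complement of [N] that gets covered. A cell
    it meets is outside the sum [S] of the two index sets, since every point of a cell in [S] is
    within two cell widths of the sumset modulo [x]. The [-1] of Cauchy-Davenport costs one cell
    width. *)
Lemma circle_sumset_cells (p : nat) x K L N : prime p -> 0 < x ->
  closed K -> K `<=` `[0, x] -> K !=set0 ->
  closed L -> L `<=` `[0, x] -> L !=set0 ->
  measurable N -> N `<=` `[0, x] ->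
  (forall k l t, K k -> L l -> 0 <= t <= x ->
     (`|t - (k + l)| <= 2 * (x / p%:R)) || (`|t - (k + l - x)| <= 2 * (x / p%:R)) -> N t) ->
  Num.min x (mlen K + mlen L - x / p%:R) <= mlen N.
Proof.
move=> pp x0 cK K0 [k0 Kk0] cL L0 [l0 Ll0] mN N0 HN.
have p0 : 0 < p%:R :> R by rewrite ltr0n prime_gt0.
have := mlen_cells pp x0 (closed_measurable cK) K0.
have := mlen_cells pp x0 (closed_measurable cL) L0.
set w := x / p%:R; have w0 : 0 < w by rewrite divr_gt0.
have pw : p%:R * w = x by rewrite /w mulrC divfK ?gt_eqF.
set Kp := cells p w K; set Lp := cells p w L.
have Kp0 : Kp != finset.set0.
  have [j jk] := @cell_index p x k0 pp x0 (K0 _ Kk0).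
  by apply/set0Pn; exists j; rewrite inE; apply/asboolP; exists k0.
have Lp0 : Lp != finset.set0.
  have [j jk] := @cell_index p x l0 pp x0 (L0 _ Ll0).
  by apply/set0Pn; exists j; rewrite inE; apply/asboolP; exists l0.
have := cauchy_davenport pp Kp0 Lp0.
set S := [set _ | _ in _, _ in _]%SET => CD mL mK.
have mI : measurable (`[0%R, x] : set R) by exact: measurable_itv.
have mD : measurable (`[0%R, x] `\` N) by exact: measurableD.
have D0 : `[0%R, x] `\` N `<=` `[0, x] by move=> t [].
have mDN : mlen (`[0%R, x] `\` N) + mlen N = x.
  have : lebesgue_measure `[0, x] = (lebesgue_measure (`[0%R, x] `\` N) +
      lebesgue_measure (`[0%R, x] `&` N))%E by exact: measureDI.
  rewrite (setIidr N0) (mlenE mD D0) (mlenE mN N0) mu_itv ?ltW// subr0.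
  by rewrite -EFinD => -[].
have {}mD : mlen (`[0%R, x] `\` N) <= (#|~: S|)%:R * w.
  rewrite (le_trans (mlen_cells pp x0 mD D0))// ler_pM2r// ler_nat.
  apply/subset_leq_card/fintype.subsetP => r.
  rewrite [r \in _]inE [r \in _]inE.
  move=> /asboolP[t [tx Nt] rt].
  apply/negP => /imset2P[j l jK lL rE]; move: jK lL.
  rewrite [j \in _]inE [l \in _]inE => /asboolP[k Kk jk] /asboolP[l' Ll ll].
  apply: Nt; apply: (HN k l') => //.
  have rv : val r = ((val j + val l) %% p)%N.
    by rewrite rE; apply: (congr1 (modn _)); exact: Fp_cast.
  have jp : (val j < p)%N by rewrite -[ltnRHS](Fp_cast pp) ltn_ord.
  have lp : (val l < p)%N by rewrite -[ltnRHS](Fp_cast pp) ltn_ord.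
  have [jlp|pjl] := ltnP (val j + val l) p.
    move: rt; rewrite rv modn_small// natrD mulrDl => rt.
    by apply/orP; left; exact: dist_cells jk ll rt.
  (* Past [p] the sum of the indices drops by [p], so the points drop by [p * w = x]: the second
     alternative in [HN]. *)
  have rjl : (val r + p = val j + val l)%N.
    rewrite rv -(subnK pjl) modnDr modn_small ?subnK// ltn_subLR//.
    by rewrite -addSn leq_add// ltnW.
  have : (val r)%:R + p%:R = (val j)%:R + (val l)%:R :> R by rewrite -!natrD rjl.
  move=> /(congr1 (fun z => z * w)); rewrite mulrDl pw mulrDl => rjl'.
  apply/orP; right; have -> : t - (k + l' - x) = t + x - (k + l') by ring.
  apply: dist_cells jk ll _; rewrite -rjl' addrAC -/w.
  by rewrite !lerD2r.
have : (#|S| + #|~: S|)%:R = p%:R :> R by rewrite cardsC card_Fp.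
rewrite natrD => /(congr1 (fun z => z * w)); rewrite mulrDl pw => cS.
have KLp : (0 < #|Kp| + #|Lp|)%N by rewrite addn_gt0 card_gt0 Kp0.
move: CD; rewrite geq_min => /orP[pS|KLS].
  rewrite ge_min; apply/orP; left.
  have : p%:R * w <= #|S|%:R * w by rewrite ler_pM2r// ler_nat.
  by rewrite pw; lra.
rewrite ge_min; apply/orP; right.
have : (#|Kp| + #|Lp|)%:R * w <= #|S|.+1%:R * w.
  by rewrite ler_pM2r// ler_nat -(prednK KLp).
by rewrite natrD -natr1 !mulrDl mul1r; lra.
Qed.

Lemma compact_sumset K L : compact K -> compact L -> compact (sumset K L).
Proof.
move=> cK cL; have -> : sumset K L = (fun q : R * R => q.1 + q.2) @` (K `*` L).
  apply/seteqP; split=> t.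
    by move=> [k Kk [l Ll <-]]; exists (k, l).
  by move=> [[k l] [Kk Ll] <-]; exists k => //; exists l.
apply: continuous_compact; last exact: compact_setX.
by apply: continuous_subspaceT => q; exact: add_continuous.
Qed.

Lemma closed_itv_compact K x y : closed K -> K `<=` `[x, y] -> compact K.
Proof. by move=> cK Kxy; exact: subclosed_compact cK (@segment_compact _ _ _) Kxy. Qed.

(* For K and L inside [0, x], its trace on [0, x] is the sumset modulo x. *)
Definition circle_sumset x K L : set R :=
  sumset K L `|` sumset (sumset K L) [set - x].

Lemma closed_circle_sumset x K L : compact K -> compact L -> closed (circle_sumset x K L).
Proof.
move=> cK cL; have cKL := compact_sumset cK cL.
apply: closedU; apply: compact_closed => //.
apply: compact_sumset => //; exact: compact_set1.
Qed.

(** The discrete bound needs room around the sumset, so it is applied to the neighbourhoods [U n],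
    with [p] large for each [n]. Their intersection is the closed sumset itself, and continuity of
    the measure from above passes to the limit. *)
Lemma raikov x K L : 0 < x ->
  closed K -> K `<=` `[0, x] -> K !=set0 ->
  closed L -> L `<=` `[0, x] -> L !=set0 ->
  Num.min x (mlen K + mlen L) <= mlen (circle_sumset x K L `&` `[0, x]).
Proof.
move=> x0 cK K0 Kn cL L0 Ln.
set S := circle_sumset x K L.
have cS : closed S by apply: closed_circle_sumset; exact: closed_itv_compact K0 || exact: closed_itv_compact L0.
pose U n := \bigcup_(s in S) ball s n.+1%:R^-1.
have oU n : open (U n) by apply: bigcup_open => s _; exact: ball_open.
pose N n := U n `&` `[0, x].
have mI : measurable (`[0%R, x] : set R) by exact: measurable_itv.
have mN n : measurable (N n).
  by apply: measurableI => //; exact: open_measurable.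
have N0 n : N n `<=` `[0, x] by move=> t [].
have NS : \bigcap_n N n = S `&` `[0, x].
  apply/seteqP; split=> [t Nt|t [St xt] n _]; last first.
    by split=> //; exists t => //; exact: ballxx.
  split; last by have [] := Nt 0%N I.
  rewrite [S](iffLR (closure_id _) cS) => B /nbhs_ballP[e/= e0 Be].
  have [n ne] : exists n, n.+1%:R^-1 < e.
    exists (Num.truncn e^-1); rewrite -[ltRHS]invrK ltf_pV2 ?posrE ?invr_gt0//.
    exact: truncnS_gt.
  have [[s Ss st] _] := Nt n I.
  exists s; split => //; apply: Be; apply: ball_sym.
  by apply: le_ball st; exact: ltW.
have mS : measurable (S `&` `[0, x]).
  by apply: measurableI => //; exact: closed_measurable.
have S0 : S `&` `[0%R, x] `<=` `[0, x] by move=> t [].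
have cvg : lebesgue_measure \o N @ \oo --> lebesgue_measure (S `&` `[0%R, x]).
  rewrite -NS; apply: nonincreasing_cvg_mu => //.
  - by have := ltry (mlen (N 0%N)); rewrite -(mlenE (mN 0%N) (N0 0%N)).
  - by rewrite NS.
  - apply/nonincreasing_seqP => n; rewrite subsetEset => t [[s Ss st] tx].
    split=> //; exists s => //; apply: le_ball st.
    by rewrite lef_pV2 ?posrE// ler_nat.
rewrite -lee_fin -(mlenE mS S0) -(cvg_lim _ cvg)//.
apply: lime_ge; first by apply/cvg_ex; eexists; exact: cvg.
apply: nearW => n /=; rewrite (mlenE (mN n) (N0 n)) lee_fin.
apply/ler_addgt0Pr => e e0.
(* The bound by [e] absorbs the lost cell; the bound by a quarter of the radius keeps two cell
   widths inside [U n]. *)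
pose d := Num.min e (n.+1%:R^-1 / 4).
have d0 : 0 < d by rewrite lt_min e0 divr_gt0// invr_gt0.
have de : d <= e by rewrite ge_min lexx.
have dn : d <= n.+1%:R^-1 / 4 by rewrite ge_min lexx orbT.
have [p pm pp] := prime_above (Num.truncn (x / d)).
have p0 : 0 < p%:R :> R by rewrite ltr0n prime_gt0.
have wd : x / p%:R < d.
  rewrite ltr_pdivrMr// mulrC -ltr_pdivrMr//.
  by apply: lt_le_trans (truncnS_gt _) _; rewrite ler_nat.
have n0 : 0 < n.+1%:R^-1 :> R by rewrite invr_gt0.
have := @circle_sumset_cells p x K L (N n) pp x0 cK K0 Kn cL L0 Ln (mN n) (N0 n).
have near1 t s : S s -> 0 <= t <= x -> `|t - s| <= 2 * (x / p%:R) -> N n t.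
  move=> Ss tx ts; split=> //; exists s => //.
  rewrite -ball_normE /ball_/= distrC (le_lt_trans ts)//.
  by move: wd dn n0; move: (x / p%:R) (n.+1%:R^-1) => u v; lra.
have HN k l t : K k -> L l -> 0 <= t <= x ->
   (`|t - (k + l)| <= 2 * (x / p%:R)) || (`|t - (k + l - x)| <= 2 * (x / p%:R)) ->
   N n t.
  move=> Kk Ll tx; have KLkl : sumset K L (k + l) by exists k => //; exists l.
  move=> /orP[|]; apply: near1 => //; first by left.
  by right; exists (k + l) => //; exists (- x).
move/(_ HN); rewrite !ge_min => /orP[h|h].
  by apply/orP; left; lra.
by apply/orP; right; lra.
Qed.

End CircleSumset.

(** * Inner Lebesgue measure of bounded sets *)

Section InnerMeasure.
Context {R : realType}.
Implicit Types (X Y K : set R) (a b c r : R).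
Local Notation mu := (@lebesgue_measure R).

(** The pushforward under the reflection gives half-open intervals their length, and this
    characterizes Lebesgue measure. *)
Lemma mu_reflect c X : measurable X -> mu ((fun t => c - t) @^-1` X) = mu X.
Proof.
move=> mX.
have mr : measurable_fun [set: measurableTypeR R]
    ((fun t => c - t) : measurableTypeR R -> measurableTypeR R).
  by apply: measurable_funB; [exact: measurable_cst|exact: measurable_id].
pose f : {mfun measurableTypeR R >-> measurableTypeR R} :=
  HB.pack ((fun t => c - t) : measurableTypeR R -> measurableTypeR R)
    (isMeasurableFun.Build _ _ _ _ _ mr).
rewrite -[LHS]/(pushforward mu f X).
apply/esym/lebesgue_measure_unique => //= _ [[a b]] _ <-.
rewrite /pushforward (_ : f @^-1` _ = `[c - b, c - a[%classic); last first.
  by apply/seteqP; split=> t /=; rewrite !in_itv/= => /andP[? ?]; apply/andP; split; lra.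
rewrite !lebesgue_measure_itv/= !lte_fin ltrD2l ltrN2.
by case: ifP => // _; rewrite -!EFinB; congr EFin; ring.
Qed.

Lemma continuous_reflect c : continuous (fun t : R => c - t).
Proof. by move=> t; apply: continuousB; [exact: cvg_cst|exact: cvg_id]. Qed.

Lemma closed_reflect c K : closed K -> closed ((fun t => c - t) @^-1` K).
Proof. by apply: closed_comp => t _; exact: continuous_reflect. Qed.

Definition lam X : R := fine (inner_lebesgue X).

Lemma inner_lebesgueE a b X : X `<=` `[a, b] -> inner_lebesgue X = (lam X)%:E.
Proof.
move=> Xab; rewrite fineK// ge0_fin_numE; last first.
  by apply: ereal_sup_ubound; exists set0; [split=> //; exact: closed0|exact: measure0].
apply: (@le_lt_trans _ _ (mu `[a, b])); last first.
  by rewrite lebesgue_measure_itv/=; case: ifP => _; rewrite ?ltry.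
apply: ge_ereal_sup => _ [K [cK KX] <-]; apply: le_measure.
- by rewrite inE; exact: closed_measurable.
- by rewrite inE; exact: measurable_itv.
- exact: subset_trans Xab.
Qed.

Lemma lam_ge a b X K : X `<=` `[a, b] -> closed K -> K `<=` X -> mlen K <= lam X.
Proof.
move=> Xab cK KX; rewrite -lee_fin -(inner_lebesgueE Xab).
rewrite -(mlenE (closed_measurable cK) (subset_trans KX Xab)).
by apply: ereal_sup_ubound; exists K.
Qed.

Lemma lam_le a b X r : X `<=` `[a, b] ->
  (forall K, closed K -> K `<=` X -> mlen K <= r) -> lam X <= r.
Proof.
move=> Xab Kr; rewrite -lee_fin -(inner_lebesgueE Xab).
apply: ge_ereal_sup => _ [K [cK KX] <-].
by rewrite (mlenE (closed_measurable cK) (subset_trans KX Xab)) lee_fin; exact: Kr.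
Qed.

Lemma lam_gt a b X r : X `<=` `[a, b] -> r < lam X ->
  exists K, [/\ closed K, K `<=` X & r < mlen K].
Proof.
move=> Xab rX; apply: contrapT => /forallNP nK.
have : lam X <= r; last by rewrite leNgt rX.
apply: (lam_le Xab) => K cK KX; rewrite leNgt; apply/negP => rK.
by apply: (nK K).
Qed.

Lemma mlen0 : mlen (set0 : set R) = 0.
Proof. by rewrite /mlen measure0. Qed.

Lemma mlen_itv a b : a <= b -> mlen `[a, b] = b - a.
Proof. by move=> ab; rewrite /mlen mu_itv. Qed.

Lemma lam_ge0 a b X : X `<=` `[a, b] -> 0 <= lam X.
Proof. by move=> Xab; rewrite -mlen0; apply: (lam_ge Xab) => //; exact: closed0. Qed.

Lemma lam_mono a b X Y : X `<=` Y -> Y `<=` `[a, b] -> lam X <= lam Y.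
Proof.
move=> XY Yab; apply: (lam_le (subset_trans XY Yab)) => K cK KX.
by apply: (lam_ge Yab) => //; exact: subset_trans XY.
Qed.

Lemma mlen_mono a b X Y : measurable X -> measurable Y ->
  X `<=` Y -> Y `<=` `[a, b] -> mlen X <= mlen Y.
Proof.
move=> mX mY XY Yab.
rewrite -lee_fin -(mlenE mX (subset_trans XY Yab)) -(mlenE mY Yab).
by apply: le_measure; rewrite ?inE.
Qed.

Lemma lam_le_itv a b X : a <= b -> X `<=` `[a, b] -> lam X <= b - a.
Proof.
move=> ab Xab; apply: (lam_le Xab) => K cK KX; rewrite -mlen_itv//.
apply: (@mlen_mono a b) => //; first exact: closed_measurable.
exact: subset_trans Xab.
Qed.

Lemma mlen_reflect c K : closed K -> mlen ((fun t => c - t) @^-1` K) = mlen K.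
Proof. by move=> cK; rewrite /mlen mu_reflect//; exact: closed_measurable. Qed.

Lemma reflect_itv a b c X : X `<=` `[a, b] ->
  (fun t => c - t) @^-1` X `<=` `[c - b, c - a].
Proof. by move=> Xab t /Xab; rewrite /= !in_itv/=; lra. Qed.

Lemma lam_reflect a b c X : X `<=` `[a, b] -> lam ((fun t => c - t) @^-1` X) = lam X.
Proof.
move=> Xab; have rX := reflect_itv (c := c) Xab.
have rK Y : (fun t => c - t) @^-1` ((fun t => c - t) @^-1` Y) = Y.
  by apply/seteqP; split=> t; rewrite /= opprB addrC subrK.
apply/eqP; rewrite eq_le; apply/andP; split.
  apply: (lam_le rX) => K cK KX; rewrite -(mlen_reflect c cK).
  apply: (lam_ge Xab); first exact: closed_reflect.
  by rewrite -[X]rK; exact: preimage_subset.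
apply: (lam_le Xab) => K cK KX; rewrite -(mlen_reflect c cK).
apply: (lam_ge rX); first exact: closed_reflect.
exact: preimage_subset.
Qed.

(** Closed subsets of [X] and [Y] are chosen independently; they meet at most in [c], which is null.
    For sets that need not be measurable, only this inequality is available. *)
Lemma lam_superadd a b c X Y : X `<=` `[a, b] -> Y `<=` `[a, b] ->
  X `&` Y `<=` [set c] -> lam X + lam Y <= lam (X `|` Y).
Proof.
move=> Xab Yab XYc; have XY : X `|` Y `<=` `[a, b] by move=> t [/Xab|/Yab].
rewrite -lerBrDr; apply: (lam_le Xab) => K cK KX.
rewrite lerBrDr addrC -lerBrDr; apply: (lam_le Yab) => L cL LY; rewrite lerBrDr addrC.
have [mK mL] := (closed_measurable cK, closed_measurable cL).
have mKL : measurable (K `&` L) by exact: measurableI.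
have KL0 : mu (K `&` L) = 0%E.
  apply: (@subset_measure0 _ _ _ mu _ [set c]) => //.
    by move=> t [Kt Lt]; apply: XYc; split; [exact: KX|exact: LY].
  exact: lebesgue_measure_set1.
have KLXY : K `|` L `<=` X `|` Y by move=> t [/KX|/LY]; [left|right].
have : mlen K + mlen L = mlen (K `|` L).
  have muL : mu L = (mlen L)%:E := mlenE mL (subset_trans LY Yab).
  have muK : mu K = (mlen K)%:E := mlenE mK (subset_trans KX Xab).
  have Lfin : (mu L < +oo)%E by rewrite muL ltry.
  have muKL : mu (K `|` L) = (mu K + mu L - mu (K `&` L))%E by exact: measureUfinr.
  by rewrite [in RHS]/mlen muKL KL0 sube0 muK muL.
move=> ->; apply: (lam_ge XY) => //; exact: closedU.
Qed.

(** Equality holds here because cutting at a point splits any closed subset into closed pieces. *)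
Lemma lam_split a b c X : X `<=` `[a, b] ->
  lam X = lam (X `&` `[a, c]) + lam (X `&` `[c, b]).
Proof.
move=> Xab; apply/eqP; rewrite eq_le; apply/andP; split; last first.
  have XE : X = (X `&` `[a, c]) `|` (X `&` `[c, b]).
    apply/seteqP; split=> [t Xt|t [[]|[]]//].
    have := Xab _ Xt; rewrite /= in_itv/= => /andP[at_ tb].
    by case: (leP t c) => tc; [left|right]; split=> //=; rewrite in_itv/= ?at_ ?tb ?tc ?ltW.
  rewrite {3}XE; apply: (@lam_superadd a b c).
  - by move=> t [/Xab].
  - by move=> t [/Xab].
  - by move=> t [[_ +] [_]]; rewrite /= !in_itv/= => ? ?; apply/eqP; rewrite eq_le; lra.
apply: (lam_le Xab) => K cK KX.
have mK := closed_measurable cK; have Kab := subset_trans KX Xab.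
have cKl : closed (K `&` `[a, c]) by apply: closedI => //; exact: interval_closed.
have cKr : closed (K `&` `[c, b]) by apply: closedI => //; exact: interval_closed.
have [mKl mKr] := (closed_measurable cKl, closed_measurable cKr).
have Klab : K `&` `[a, c] `<=` `[a, b] by move=> t [/Kab].
have Krab : K `&` `[c, b] `<=` `[a, b] by move=> t [/Kab].
have KE : K = (K `&` `[a, c]) `|` (K `&` `[c, b]).
  apply/seteqP; split=> [t Kt|t [[]|[]]//].
  have := Kab _ Kt; rewrite /= in_itv/= => /andP[at_ tb].
  by case: (leP t c) => tc; [left|right]; split=> //=; rewrite in_itv/= ?at_ ?tb ?tc ?ltW.
apply: (@le_trans _ _ (mlen (K `&` `[a, c]) + mlen (K `&` `[c, b]))).
  rewrite -lee_fin EFinD -(mlenE mK Kab) -(mlenE mKl Klab) -(mlenE mKr Krab).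
  by rewrite {1}KE; exact: measureU2.
apply: lerD.
  apply: (@lam_ge a b) => //; first by move=> t [/Xab].
  by move=> t [/KX].
apply: (@lam_ge a b) => //; first by move=> t [/Xab].
by move=> t [/KX].
Qed.

End InnerMeasure.

(** * Density and growth of the blocks of a stable set *)

Section LeftStable.
Context {R : realType}.
Variables (A : set R) (d : R).
Hypothesis Ad : A `<=` `[0, d].
Hypothesis A_stable : forall s t, A s -> A t -> s + t <= d -> A (s + t).
Hypothesis A_half : lam A = d / 2.
Implicit Types (K L X : set R) (a b c s t x y : R).

Local Notation f y := (lam (A `&` `[0, y])).
Local Notation g a b := (lam (A `&` `[a, b])).

Let subI a b : A `&` `[a, b] `<=` `[a, b].
Proof. by move=> t []. Qed.

Lemma lam_cut a b c : a <= b -> b <= c -> g a c = g a b + g b c.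
Proof.
move=> ab bc; rewrite (lam_split b (@subI a c)); congr (lam _ + lam _).
  apply/seteqP; split=> t [At]; first by case: At.
  rewrite /= !in_itv/= => /andP[at_ tb]; split; rewrite /= ?in_itv/= ?at_ ?tb//.
  by split=> //; rewrite (le_trans tb).
apply/seteqP; split=> t [At]; first by case: At.
rewrite /= !in_itv/= => /andP[bt tc]; split; rewrite /= ?in_itv/= ?bt ?tc//.
by split=> //; rewrite (le_trans ab).
Qed.

Lemma lam_total : f d = d / 2.
Proof. by rewrite (setIidl Ad). Qed.

(** The right end is excluded from the hypothesis because in [lam_half] it is an infimum of missing
    points, which may itself be missing. *)
Lemma lam_ge_gap a b : a <= b -> (forall t, a <= t < b -> A t) -> b - a <= g a b.
Proof.
move=> ab abA; apply/ler_addgt0Pr => e e0.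
have [eab|eab] := leP e (b - a); last first.
  by have := lam_ge0 (@subI a b); lra.
rewrite -lerBlDr (_ : b - a - e = mlen `[a, b - e]); last by rewrite mlen_itv; lra.
apply: (lam_ge (@subI a b)); first exact: interval_closed.
move=> t; rewrite /= in_itv/= => /andP[at_ tb]; split; last first.
  by rewrite /= in_itv/= at_/=; lra.
by apply: abA; rewrite at_/=; lra.
Qed.

(* A_y and y - A_y are disjoint as soon as y is missing from A. *)
Lemma lam_half_notin y : 0 <= y <= d -> ~ A y -> f y <= y / 2.
Proof.
move=> /andP[y0 yd] Ay; pose X := A `&` `[0, y].
have X0 : X `<=` `[0, y] by exact: subI.
have Y0 : (fun t => y - t) @^-1` X `<=` `[0, y].
  by have := @reflect_itv _ _ _ y _ X0; rewrite subrr subr0.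
have XY : X `&` (fun t => y - t) @^-1` X `<=` [set 0].
  move=> t [[At _] [Ayt _]]; exfalso; apply: Ay.
  by have := A_stable At Ayt; rewrite addrC subrK; exact.
have := lam_superadd X0 Y0 XY; rewrite (lam_reflect y X0).
have : lam (X `|` (fun t => y - t) @^-1` X) <= y - 0.
  by apply: lam_le_itv => // t [/X0|/Y0].
by rewrite /X; lra.
Qed.

(** Points of [E] close to [inf E] are missing from [A], so [lam_half_notin] applies to them, while
    [A] fills the stretch from [y] to [inf E]. Removing a stretch of density 1 from a bound of
    density 1/2 leaves at most [y / 2]. If [E] is empty, the total [d / 2] takes the place of that
    bound. *)
Lemma lam_half y : 0 <= y <= d -> f y <= y / 2.
Proof.
move=> /andP[y0 yd]; pose E := [set t | y <= t <= d /\ ~ A t].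
have cutd := lam_cut y0 yd; have fd := lam_total.
have [[t0 Et0]|En] := pselect (E !=set0); last first.
  have gyd : d - y <= g y d.
    apply: lam_ge_gap => // t /andP[yt td].
    by apply: contrapT => At; apply: En; exists t; split=> //; rewrite yt ltW.
  lra.
have Einf : has_inf E by split; [exists t0|exists y => t [/andP[]]].
have yz : y <= inf E by apply: lb_le_inf; [exists t0|move=> t [/andP[]]].
have gz : inf E - y <= g y (inf E).
  apply: lam_ge_gap => // t /andP[yt tz]; apply: contrapT => At.
  have : inf E <= t; last by rewrite leNgt tz.
  apply: ge_inf; first by case: Einf.
  split=> //; rewrite yt/=; have [/andP[_ t0d] _] := Et0.
  by rewrite (le_trans (ltW tz))// (le_trans _ t0d)//; apply: ge_inf => //; case: Einf.
apply/ler_addgt0Pr => e e0.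
have [t [/andP[yt td] At] tz] := inf_adherent e0 Einf.
have zt : inf E <= t by apply: ge_inf; [case: Einf|split=> //; rewrite yt].
have t0' : 0 <= t by lra.
have := @lam_half_notin t; rewrite t0' td => /(_ isT At).
have := lam_cut y0 yt; have := lam_cut yz zt; have := lam_ge0 (@subI (inf E) t).
lra.
Qed.

Lemma closed_shift c K : closed K -> closed ((fun t => t + c) @^-1` K).
Proof.
apply: closed_comp => t _; apply: continuousD; [exact: cvg_id|exact: cvg_cst].
Qed.

Lemma mlen_shift c K : closed K -> mlen ((fun t => t + c) @^-1` K) = mlen K.
Proof.
(* A translation is a composite of two reflections. *)
move=> cK; rewrite -[RHS](mlen_reflect c)// -[RHS](mlen_reflect 0); last exact: closed_reflect.
by congr mlen; apply/seteqP; split=> t /=; rewrite sub0r opprK addrC.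
Qed.

(* Modulo x, the part of A above s + x contains the sum of its part above s
   and A_x, because x lies in A; the subtracted maximum is what truncation at
   d may remove. *)
Lemma lam_step x s : A x -> 0 < x -> 0 <= s -> s + x <= d ->
  0 < f x -> 0 < g s (s + x) ->
  Num.min x (g s (s + x) + f x) - Num.max 0 (s + x + x - d) <= g (s + x) (s + x + x).
Proof.
move=> Ax x0 s0 sxd f0 g0; apply/ler_addgt0Pr => e e0.
(* The maximum with 0 makes the closed set nonempty, as Raikov's inequality requires. *)
have [K [cK KA Kg]] : exists K, [/\ closed K, K `<=` A `&` `[s, s + x] &
    Num.max 0 (g s (s + x) - e / 2) < mlen K].
  by apply: lam_gt; [exact: subI|rewrite gt_max g0/=; lra].
have [L [cL LA Lg]] : exists L, [/\ closed L, L `<=` A `&` `[0, x] &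
    Num.max 0 (f x - e / 2) < mlen L].
  by apply: lam_gt; [exact: subI|rewrite gt_max f0/=; lra].
move: Kg Lg; rewrite !gt_max => /andP[K0 Kg] /andP[L0 Lg].
have nonempty X : 0 < mlen X -> X !=set0.
  by move=> X0; apply/set0P; apply: contraTneq X0 => ->; rewrite mlen0 ltxx.
pose K' := (fun t => t + s) @^-1` K.
have cK' : closed K' by exact: closed_shift.
have K'x : K' `<=` `[0, x] by move=> t /KA [_]; rewrite /= !in_itv/=; lra.
have Lx : L `<=` `[0, x] by move=> t /LA [].
have K'0 : K' !=set0 by apply: nonempty; rewrite /K' mlen_shift.
have := raikov x0 cK' K'x K'0 cL Lx (nonempty _ L0).
rewrite /K' mlen_shift// -/K'; set T := _ `&` _.
have cT : closed T.
  apply: closedI; last exact: interval_closed.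
  by apply: closed_circle_sumset; apply: closed_itv_compact; eassumption.
pose T' := (fun t => t + - (s + x)) @^-1` T.
have cT' : closed T' by exact: closed_shift.
rewrite -(mlen_shift (- (s + x)) cT) -/T' => KLT.
have T'x : T' `<=` `[s + x, s + x + x].
  by move=> t [_]; rewrite /= !in_itv/=; lra.
have T'A t : T' t -> t <= d -> A t.
  move=> T't td; have := T'x _ T't; rewrite /= in_itv/= => /andP[sxt _].
  move: T't => [[]].
    (* Without wrap-around the sum of the two elements is [t - x], and stability is used again with
       [x]; with wrap-around it is [t] itself. *)
    move=> [k /KA[Ak _] [l /LA[Al _] klt]] _.
    have klE : k + s + l = t - x by rewrite addrAC klt; ring.
    have := A_stable Ak Al; rewrite klE => /(_ _)/A_stable; rewrite -[X in A X](subrK x t).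
    by apply => //; lra.
  move=> [_ [k /KA[Ak _] [l /LA[Al _] <-]] [_ -> klt]] _.
  have klE : k + s + l = t by lra.
  by rewrite -klE; apply: A_stable => //; rewrite klE.
have T'lam : mlen T' <= lam T' by exact: lam_ge T'x cT' _.
have lamA y : y <= d -> y <= s + x + x ->
    lam (T' `&` `[s + x, y]) <= g (s + x) (s + x + x).
  move=> yd yx; apply: (lam_mono _ (@subI _ _)) => t [T't ty]; split; last exact: T'x.
  apply: T'A => //; move: ty; rewrite /= in_itv/=; lra.
have KL : Num.min x (g s (s + x) + f x) - e <= Num.min x (mlen K + mlen L).
  by rewrite le_min !lerBlDr !ge_min; apply/andP; split; apply/orP; [left|right]; lra.
(* Only the part of [T'] up to [d] is known to lie in [A]; the rest has measure at most
   [s + x + x - d]. *)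
have [dx|xd] := leP d (s + x + x).
  have := lamA d (lexx d) dx; have := lam_split d T'x.
  have : lam (T' `&` `[d, s + x + x]) <= s + x + x - d by apply: lam_le_itv => // t [].
  by rewrite max_r ?subr_ge0//; lra.
have := lamA _ (ltW xd) (lexx _); rewrite (setIidl T'x).
by rewrite max_l; [lra|rewrite subr_le0 ltW].
Qed.

(** The second bound sums the first over the blocks [0] to [i]. It is carried along because, with
    [lam_half] at the end of the next block, it excludes the alternative [x] of the minimum in
    [lam_step]. *)
Lemma lam_multiple x (i : nat) : A x -> 0 < x -> 0 < f x -> i.+1%:R * x <= d ->
  i.+1%:R * f x <= g (i%:R * x) (i%:R * x + x) /\
  i.+1%:R * i.+2%:R / 2 * f x <= f (i%:R * x + x).
Proof.
move=> Ax x0 f0; elim: i => [|i IHi] ix.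
  by rewrite mul0r add0r !mul1r divff ?mul1r.
have e1 : i.+1%:R = i%:R + 1 :> R by rewrite natr1.
have e2 : i.+2%:R = i%:R + 2 :> R by rewrite -!natr1; ring.
have e3 : i.+3%:R = i%:R + 3 :> R by rewrite -!natr1; ring.
have i0 : 0 <= i%:R :> R by [].
have xE : i.+1%:R * x = i%:R * x + x by rewrite e1; ring.
have xxE : i.+2%:R * x = i%:R * x + x + x by rewrite e2; ring.
have ixd : i%:R * x + x + x <= d by rewrite -xxE.
have ix0 : 0 <= i%:R * x by rewrite mulr_ge0// ltW.
have [|] := IHi; first by rewrite xE; lra.
set c := g (i%:R * x) _; set F := f (i%:R * x + x) => cf Ff.
have c0 : 0 < c by apply: lt_le_trans cf; rewrite mulr_gt0.
have xsd : i%:R * x + x <= d by lra.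
have := @lam_step x (i%:R * x) Ax x0 ix0 xsd f0 c0.
rewrite -/c max_l ?subr_le0// subr0 => step.
have Fc : f (i%:R * x + x + x) = F + g (i%:R * x + x) (i%:R * x + x + x).
  by apply: lam_cut; lra.
have half : F + g (i%:R * x + x) (i%:R * x + x + x) <= (i%:R * x + x + x) / 2.
  by rewrite -Fc; apply: lam_half; rewrite ixd andbT; lra.
move: step; set c' := g _ (_ + x + x) in half Fc *; rewrite ge_min => step.
have {}step : i.+2%:R * f x <= c'.
  case/orP: step => [xc'|]; last by rewrite e2; move: cf; rewrite e1; lra.
  (* A full block A ∩ [(i+1)x, (i+2)x] would be too dense for [lam_half]. *)
  have [//|c'f] := leP (i.+2%:R * f x) c'.
  have : i.+2%:R * f x <= i%:R * x / i.+1%:R.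
    rewrite ler_pdivlMr//; move: Ff half; rewrite e1 e2; nra.
  rewrite ler_pdivlMr// e1; move: c'f xc'; rewrite e2; nra.
rewrite xE; split=> //; rewrite Fc; move: Ff step; rewrite e1 e2 e3; nra.
Qed.

(** Let [F] be the measure of [A] before the last block. That block holds [d / 2 - F], since [A]
    ends at [d], so [lam_step] gives [k * f x <= d / 2 - F + (k * x - d)]; the lower bound on [F]
    from [lam_multiple] concludes. *)
Lemma lam_mem_bound x (k : nat) : A x -> 0 < x -> (2 <= k)%N ->
  k.-1%:R * x <= d -> d < k%:R * x -> 0 < f x ->
  k%:R * k.+1%:R / 2 * f x <= k%:R * x - d / 2.
Proof.
case: k => [//|[//|i]] Ax x0 _ /= ixd dix f0.
have e1 : i.+1%:R = i%:R + 1 :> R by rewrite natr1.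
have e2 : i.+2%:R = i%:R + 2 :> R by rewrite -!natr1; ring.
have e3 : i.+3%:R = i%:R + 3 :> R by rewrite -!natr1; ring.
have i0 : 0 <= i%:R :> R by [].
have [] := @lam_multiple x i Ax x0 f0 ixd.
set c := g (i%:R * x) _; set F := f (i%:R * x + x) => cf Ff.
have xE : i.+1%:R * x = i%:R * x + x by rewrite e1; ring.
have xxE : i.+2%:R * x = i%:R * x + x + x by rewrite e2; ring.
have ix0 : 0 <= i%:R * x by rewrite mulr_ge0// ltW.
have c0 : 0 < c by apply: lt_le_trans cf; rewrite mulr_gt0.
rewrite xE in ixd; rewrite xxE in dix *.
have := @lam_step x (i%:R * x) Ax x0 ix0 ixd f0 c0.
rewrite -/c max_r; last by rewrite subr_ge0 ltW.
have -> : g (i%:R * x + x) (i%:R * x + x + x) = d / 2 - F.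
  have <- : f (i%:R * x + x + x) = d / 2.
    rewrite -lam_total; congr lam; apply/seteqP; split=> t [At] _.
      by split=> //; exact: Ad.
    by split=> //; have := Ad At; rewrite /= !in_itv/=; lra.
  have -> : f (i%:R * x + x + x) = F + g (i%:R * x + x) (i%:R * x + x + x).
    by apply: lam_cut; lra.
  by rewrite [F + _]addrC addrK.
rewrite lerBlDr ge_min; set u := f x in f0 cf Ff *; set r := _ + _ - d => step.
have {}step : x <= d / 2 - F + r \/ i.+2%:R * u <= d / 2 - F + r.
  by case/orP: step => [|cu]; [left|right; move: cf cu; rewrite e1 e2; lra].
have [ku|uk] := leP (i.+2%:R * u) x.
  have {}step : i.+2%:R * u <= d / 2 - F + r by case: step => //; exact: le_trans.
  by move: Ff step; rewrite /r e1 e2 e3; lra.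
(* This case is impossible: with [k = i + 2], having [F > (k - 1) * x / 2] and
   [F <= (k - 1) * x - d / 2] would give [d < (k - 1) * x]. *)
have {}step : x <= d / 2 - F + r by case: step => //; apply: le_trans; exact: ltW.
have : 0 < i.+1%:R * (i.+2%:R * u - x) by rewrite mulr_gt0// subr_gt0.
by move: Ff step ixd; rewrite /r e1 e2; lra.
Qed.

End LeftStable.

(** * Monotonicity of [h] *)

Section HBounds.
Context {R : realType}.
Implicit Types (x y z : R).

(** The bounds are the values of the affine piece at its two ends. The upper one for [k] is the
    lower one for [k - 1], which makes different pieces comparable. *)
Lemma h_bounds (k : nat) y : (2 <= k)%N -> y \in `]k%:R^-1, k.-1%:R^-1] ->
  (k%:R * k.+1%:R)^-1 <= h y <= (k%:R * k.-1%:R)^-1.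
Proof.
move=> k2 yk; rewrite (hE k2 yk); move: yk; rewrite in_itv/=.
case: k k2 => [//|[//|k]] _ /=.
have e1 : k.+1%:R = k%:R + 1 :> R by rewrite natr1.
have e2 : k.+2%:R = k%:R + 2 :> R by rewrite -!natr1; ring.
have e3 : k.+3%:R = k%:R + 3 :> R by rewrite -!natr1; ring.
have k0 : 0 <= k%:R :> R by [].
rewrite e1 e2 e3; move: k0; move: (k%:R : R) => n n0 /andP[ny yn].
have n3 : 0 < (n + 3)^-1 by rewrite invr_gt0; lra.
have -> : ((n + 2) * (n + 3))^-1 = (n + 3)^-1 * (2 * (n + 2)^-1 - (n + 2)^-1).
  by field; rewrite !gt_eqF//; lra.
have -> : ((n + 2) * (n + 1))^-1 = (n + 3)^-1 * (2 * (n + 1)^-1 - (n + 2)^-1).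
  by field; rewrite !gt_eqF//; lra.
by rewrite !ler_pM2l//; lra.
Qed.

Lemma h_ge0 y : 0 <= y <= 1 -> 0 <= h y.
Proof.
move=> /andP[]; rewrite le_eqVlt => /predU1P[<-|y0 y1]; first by rewrite h0.
have [|k k2 yk] := @h_pieceP R y; first by rewrite y0.
by have /andP[+ _] := h_bounds k2 yk; apply: le_trans; rewrite invr_ge0.
Qed.

Lemma h_mono y z : 0 <= y -> y <= z -> z <= 1 -> h y <= h z.
Proof.
move=> y0 yz z1; have z0 := le_trans y0 yz.
have [yn|y0'] := leP y 0.
  have -> : y = 0 by apply/le_anti; rewrite yn.
  by rewrite h0; apply: h_ge0; rewrite z0.
have [|k k2 yk] := @h_pieceP R y; first by rewrite y0' (le_trans yz).
have [|j j2 zj] := @h_pieceP R z; first by rewrite z1 (lt_le_trans y0').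
have [kj|jk|jk] := ltngtP k j.
(* Pieces of larger index lie further left, so [k < j] contradicts [y <= z]. *)
- move: (yk) (zj); rewrite !in_itv/= => /andP[ky _] /andP[_ zj'].
  have : j.-1%:R^-1 <= k%:R^-1 :> R.
    rewrite lef_pV2 ?posrE ?ltr0n// ?ler_nat//; lia.
  by move=> jk; have := le_lt_trans jk ky; lra.
- have /andP[_ hy] := h_bounds k2 yk; have /andP[hz _] := h_bounds j2 zj.
  rewrite (le_trans hy)// (le_trans _ hz)//.
  rewrite lef_pV2 ?posrE -?natrM ?ltr0n ?ler_nat ?muln_gt0; [|lia|lia].
  by rewrite mulnC; apply: leq_mul; lia.
- move: zj j2; rewrite -jk => zj _; rewrite (hE k2 yk) (hE k2 zj).
  by rewrite ler_pM2l ?invr_gt0// lerD2r ler_pM2l.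
Qed.

End HBounds.

(** * The bound by [h], at points of [A] and then everywhere *)

Section LeftStableBound.
Context {R : realType}.
Variables (A : set R) (d : R).
Hypotheses (d0 : 0 < d) (Ad : A `<=` `[0, d]).
Hypothesis A_stable : forall s t, A s -> A t -> s + t <= d -> A (s + t).
Hypothesis A_half : lam A = d / 2.
Implicit Types (x : R).

Local Notation f y := (lam (A `&` `[0, y])).

Lemma lam_mem_le x : A x -> f x <= d * h (x / d).
Proof.
move=> Ax; have := Ad Ax; rewrite /= in_itv/= => /andP[x0 xd].
have xd01 : 0 <= x / d <= 1 by rewrite divr_ge0 ?(ltW d0)//= ler_pdivrMr// mul1r.
have dh0 : 0 <= d * h (x / d) by rewrite mulr_ge0 ?h_ge0// ltW.
have [/le_trans->//|f0] := leP (f x) 0.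
have {}x0 : 0 < x.
  rewrite lt_neqAle x0 andbT; apply: contraTneq f0 => <-.
  by rewrite -leNgt -[leRHS](subrr (0 : R)); apply: lam_le_itv => // t [].
have [|k k2 xk] := @h_pieceP R (x / d); first by rewrite divr_gt0//; case/andP: xd01.
rewrite (hE k2 xk); move: xk; rewrite in_itv/= => /andP[kx xk].
have k0 : 0 < k%:R :> R by rewrite ltr0n (leq_trans _ k2).
have k1 : 0 < k.-1%:R :> R by rewrite ltr0n -ltnS prednK// (leq_trans _ k2).
have kxd : d < k%:R * x.
  by move: kx; rewrite ltr_pdivlMr// mulrC ltr_pdivrMr// mulrC.
have xkd : k.-1%:R * x <= d.
  by move: xk; rewrite ler_pdivrMr// mulrC ler_pdivlMr// mulrC.
have := lam_mem_bound Ad A_stable A_half Ax x0 k2 xkd kxd f0.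
have kS : 0 < k.+1%:R :> R by [].
move: kS; move: (k.+1%:R : R) (k%:R : R) k0 => m n n0 m0 H.
(* This is the right side of [lam_mem_bound] divided by [k * k.+1 / 2], with [n] for [k] and [m] for
   [k.+1]. *)
have -> : d * (m^-1 * (2 * (x / d) - n^-1)) = (n * x - d / 2) / (n * m / 2).
  by field; rewrite !gt_eqF.
by rewrite ler_pdivlMr ?divr_gt0 ?mulr_gt0// mulrC.
Qed.

(** The supremum of the part of [A] up to [x] need not belong to [A], so an element [y] within [e]
    of it is used: the part above [y] has measure at most [e], and monotonicity of [h] replaces [y]
    by [x]. *)
Lemma lam_le_h x : 0 <= x <= d -> f x <= d * h (x / d).
Proof.
move=> /andP[x0 xd].
have xd01 : 0 <= x / d <= 1 by rewrite divr_ge0 ?(ltW d0)//= ler_pdivrMr// mul1r.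
have dh0 : 0 <= d * h (x / d) by rewrite mulr_ge0 ?h_ge0// ltW.
have [/le_trans->//|f0] := leP (f x) 0.
have [a0 Aa0] : A `&` `[0, x] !=set0.
  apply/set0P; apply: contraTneq f0 => ->; rewrite -leNgt.
  by rewrite -[leRHS](subrr (0 : R)); apply: lam_le_itv.
have Asup : has_sup (A `&` `[0, x]).
  by split; [exists a0|exists x => t [_]; rewrite /= in_itv/= => /andP[]].
apply/ler_addgt0Pr => e e0.
have [y [Ay yx] sy] := sup_adherent e0 Asup.
move: yx; rewrite /= in_itv/= => /andP[y0 yx].
have s_ub t : A t -> 0 <= t <= x -> t <= sup (A `&` `[0, x]).
  by move=> At tx; apply: sup_upper_bound => //; split.
have ys : y <= sup (A `&` `[0, x]) by apply: s_ub => //; rewrite y0.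
rewrite (lam_cut _ y0 yx); apply: lerD.
  apply: le_trans (lam_mem_le Ay) _; rewrite ler_pM2l//.
  case/andP: xd01 => _ xd1; apply: h_mono => //; first by rewrite divr_ge0// ltW.
  by rewrite ler_pM2r// invr_gt0.
apply: (@le_trans _ _ (sup (A `&` `[0, x]) - y)); last lra.
apply: lam_le_itv => // t [At]; rewrite /= !in_itv/= => /andP[yt tx].
by rewrite yt s_ub// tx (le_trans y0).
Qed.

End LeftStableBound.

Theorem theorem4 (R : realType) (A : set R) (hA : left_stable A)
    (hd : 0 < diam A / 2)
    (hlam : inner_lebesgue A = (diam A / 2)%:E)
    (x : R) (hx : 0 <= x <= diam A) :
  (inner_lebesgue (A `&` `[0%R, x]) <= (diam A * h (x / diam A))%R%:E)%E.
Proof.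
have [A0 [M [_ AM]] infA stabA] := hA.
have d0 : 0 < diam A by move: hd; rewrite pmulr_lgt0// invr_gt0.
(* [bounded_set] gives bounds only strictly above [M], hence [M + 1]. *)
have MA t : A t -> `|t| <= M + 1 by apply: AM; rewrite ltrDl.
have Asup : has_sup A.
  by split=> //; exists (M + 1) => t /MA; apply: le_trans; exact: ler_norm.
have Ainf : has_inf A.
  by split=> //; exists (- (M + 1)) => t /MA; rewrite ler_norml => /andP[].
have Ad : A `<=` `[0, diam A].
  move=> t At; rewrite /= in_itv/= /diam infA subr0 sup_upper_bound// andbT.
  by rewrite -infA ge_inf//; case: Ainf.
have A_stable s t : A s -> A t -> s + t <= diam A -> A (s + t).
  move=> As At std; rewrite -stabA; split; first by exists s => //; exists t.
  move: (Ad _ As) (Ad _ At); rewrite /= !in_itv/= std andbT => /andP[s0 _] /andP[t0 _].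
  exact: addr_ge0.
have A_half : lam A = diam A / 2 by rewrite /lam hlam.
rewrite (@inner_lebesgueE _ 0 x) ?lee_fin; last by move=> t [].
exact: lam_le_h.
Qed.
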